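(* For every integer $n \ge 3$: $\phi_{3n}(3) = v(n)$ if $v(n) \equiv 1 \pmod 3$ or $v(n) = 3$, and $\phi_{3n}(3) = -v(n)$ if $v(n) \equiv -1 \pmod 3$.
   Context: For an integer $m \ge 3$, let $\phi_m(x) \in \mathbb{Z}[x]$ denote the minimal polynomial of $4\sin^2\left(\frac{\pi}{m}\right)$, normalized (up to sign) so that its constant term is positive; equivalently, $\phi_m(x) = \prod_{0 < j < \frac{m}{2},\ \gcd(j,m)=1} \left(4\sin^2\left(\frac{j\pi}{m}\right) - x\right)$. For an integer $n > 1$, define $v(n) = p$ if $n = p^k$ is a power ($k \ge 1$) of a prime $p$, and $v(n) = 1$ otherwise. *)

(* Defs.v *)
From HB Require Import structures.
From mathcomp Require Import all_boot all_order all_algebra.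
From mathcomp Require Import boolp classical_sets reals trigo.

Set Implicit Arguments.
Unset Strict Implicit.
Unset Printing Implicit Defensive.

Import Order.TTheory GRing.Theory Num.Theory.
Local Open Scope classical_set_scope.
Local Open Scope ring_scope.

Definition is_minpoly (R : realType) (x : R) (q : {poly rat}) : Prop :=
  [/\ q \is monic, root (map_poly (ratr : rat -> R) q) x
    & forall r : {poly rat}, r != 0 -> root (map_poly (ratr : rat -> R) r) x ->
        (size q <= size r)%N].

Definition is_phi (R : realType) (m : nat) (p : {poly int}) : Prop :=
  0 < p`_0 /\
  exists2 q : {poly rat}, is_minpoly (4 * sin (pi / m%:R : R) ^+ 2) q
    & map_poly (intr : int -> rat) p = q \/ map_poly (intr : int -> rat) p = - q.

(* There is at most one p with [is_phi R m p]; the default value 0 would only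
   be returned if there were none, and 0 does not satisfy [is_phi R m]. *)
Definition phi (R : realType) (m : nat) : {poly int} :=
  xget 0 [set p : {poly int} | is_phi R m p].

(* The prime p is determined by n; 1 is the value when n is not a prime power. *)
Definition v (n : nat) : nat :=
  xget 1%N [set p : nat | prime p /\ exists2 k : nat, (1 <= k)%N & n = (p ^ k)%N].

(* Main.v *)
(* The cyclotomic polynomial Phi_m is palindromic of degree 2d, so
   Phi_m(z) = z^d g(z + 1/z) with g monic over Z. The polynomial of the theorem
   is g(2 - x): if r kills 4 sin^2(pi/m) = 2 - z - 1/z with z = exp(2 i pi/m),
   then X^(deg r) r(2 - X - 1/X) kills z, hence is divisible by Phi_m, which
   forces deg r >= d. For m = 3n its value at 3 is c = g(-1), and
   Phi_m(w) = w^d c for a primitive cube root of unity w. Moebius inversion of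
   X^k - 1 = prod_(d | k) Phi_d at w gives |c| = v(n). If n is not a power of 3,
   then c = g(2) = Phi_3n(1) = 1 modulo 3, which determines the sign; otherwise
   Phi_3n = X^(2n) + X^n + 1 and d = n, so c = 3. *)

Require Import Defs.
From HB Require Import structures.
From mathcomp Require Import all_boot all_order all_algebra all_field.
From mathcomp Require Import boolp classical_sets reals trigo.
From mathcomp Require Import complex ring lra zify.

Set Implicit Arguments.
Unset Strict Implicit.
Unset Printing Implicit Defensive.

Import Order.TTheory GRing.Theory Num.Theory.
Local Open Scope ring_scope.

Local Notation pZto F := (map_poly (intr : int -> F)).
Local Notation pZtoQ := (map_poly (intr : int -> rat)).
Local Notation pQto F := (map_poly (ratr : rat -> F)).

(** * Roots and irreducibility of cyclotomic polynomials over general fields *)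

Lemma pZtoQto (F : numFieldType) (p : {poly int}) : pQto F (pZtoQ p) = pZto F p.
Proof. by rewrite -map_poly_comp; apply: eq_map_poly => c /=; rewrite ratr_int. Qed.

Lemma horner_Xn_sub_1_Cyclotomic (F : comNzRingType) n (z : F) : (0 < n)%N ->
  \prod_(d <- divisors n) (pZto F 'Phi_d).[z] = z ^+ n - 1.
Proof.
move=> n_gt0; rewrite -horner_prod -rmorph_prod prod_Cyclotomic //.
by rewrite rmorphB rmorph1 /= map_polyXn !hornerE.
Qed.

(** As a root of X^m - 1, z is a root of some Phi_d with d | m; then z^d = 1, so m | d and d = m. *)
Lemma root_Cyclotomic_prim (F : idomainType) m (z : F) :
  m.-primitive_root z -> root (pZto F 'Phi_m) z.
Proof.
move=> prz; have m_gt0 := prim_order_gt0 prz.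
have := horner_Xn_sub_1_Cyclotomic z m_gt0.
rewrite (prim_expr_order prz) subrr => /eqP.
rewrite prodf_seq_eq0 => /hasP[d]; rewrite -dvdn_divisors //= => dm d0.
suff -> : m = d by [].
have d_gt0 := dvdn_gt0 m_gt0 dm.
apply/eqP; rewrite eqn_dvd dm andbT (prim_order_dvd prz) -subr_eq0.
rewrite -(horner_Xn_sub_1_Cyclotomic z d_gt0) prodf_seq_eq0.
by apply/hasP; exists d => //; rewrite -dvdn_divisors.
Qed.

Lemma root_CyclotomicC m (z : algC) : (0 < m)%N ->
  root (pZto algC 'Phi_m) z = m.-primitive_root z.
Proof.
move=> m_gt0; have [w prw] := C_prim_root_exists m_gt0.
by rewrite (Cintr_Cyclotomic prw) root_cyclotomic.
Qed.

(* For F = algC this is the irreducibility of Phi_m over rat; it transfers to F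
   because gcds do not depend on the field. *)
Lemma Cyclotomic_dvd (F : numFieldType) m (z : F) (r : {poly rat}) :
  m.-primitive_root z -> root (pQto F r) z -> pZtoQ 'Phi_m %| r.
Proof.
move=> prz rz; have m_gt0 := prim_order_gt0 prz.
have [w prw] := C_prim_root_exists m_gt0.
set f := pZtoQ 'Phi_m.
have f0 : f != 0.
  by rewrite monic_neq0 // monic_map ?Cyclotomic_monic.
have [p [pE _] pP] := minCpolyP w.
have fE : f = p.
  apply: (map_poly_inj (ratr : {rmorphism rat -> algC})); rewrite -pE (minCpoly_cyclotomic prw).
  by rewrite -(Cintr_Cyclotomic prw) /f pZtoQto.
have fP q : root (pQto algC q) w = (f %| q) by rewrite pP fE.
(* As f = k h is the minimal polynomial of [w], it divides k or h. If f | k, then h is a nonzero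
   constant, which cannot vanish at z. *)
have := divpK (dvdp_gcdl f r); set h := gcdp f r; set k := f %/ h => fhk.
have hz : root (pQto F h) z.
  by rewrite gcdp_map root_gcd rz pZtoQto root_Cyclotomic_prim.
have : root (pQto algC (k * h)) w by rewrite fhk fP.
rewrite rmorphM rootM !fP => /orP[fk|fh]; last first.
  by apply: dvdp_trans fh (dvdp_gcdr _ _).
have kh0 : k * h != 0 by rewrite fhk.
have [k0 h0] : k != 0 /\ h != 0 by apply/andP; rewrite -negb_or -mulf_eq0.
have := dvdp_leq k0 fk; rewrite -fhk size_mul // => le1.
have /size_poly1P[c c0 hE] : size h == 1%N.
  rewrite -size_poly_gt0 in h0; rewrite -size_poly_gt0 in k0; lia.
by move: hz; rewrite hE map_polyC /= rootC fmorph_eq0 (negPf c0).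
Qed.

(** * Palindromicity and even degree *)

(** The reversal g of f = Phi_m kills the primitive root 1/w. So does g - f_0 f, which has degree
    below D and must vanish, since Phi_m divides it. As f(1) = g(1) is nonzero, f_0 = 1. *)
Lemma Cyclotomic_symm m i : (1 < m)%N -> (i <= totient m)%N ->
  'Phi_m`_(totient m - i) = 'Phi_m`_i.
Proof.
move=> m_gt1; have m_gt0 := ltnW m_gt1.
have [w prw] := C_prim_root_exists m_gt0.
have w0 : w != 0 by rewrite (prim_root_eq0 prw) -lt0n.
set f := 'Phi_m; set D := totient m.
have sf : size f = D.+1 := size_Cyclotomic m.
have lf : f`_D = 1.
  by have /monicP := Cyclotomic_monic m; rewrite /lead_coef -/f sf.
pose g : {poly int} := \poly_(i < D.+1) f`_(D - i).
have gw : root (pZto algC g) w^-1.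
  rewrite /root.
  have -> : (pZto algC g).[w^-1] = w ^- D * (pZto algC f).[w].
    have szg : (size (pZto algC g) <= D.+1)%N by rewrite (leq_trans (size_poly _ _)) ?size_poly.
    have szf : (size (pZto algC f) <= D.+1)%N by rewrite (leq_trans (size_poly _ _)) ?sf.
    rewrite !(horner_coef_wide _ szg) (horner_coef_wide _ szf).
    rewrite (reindex_inj rev_ord_inj) /= mulr_sumr; apply: eq_bigr => j _.
    have jD : (j <= D)%N by rewrite -ltnS.
    rewrite !coef_map /= subSS coef_poly ltnS leq_subr subKn // mulrCA; congr (_ * _).
    by rewrite exprVn -[X in w ^- X * _](subnK jD) exprD invfM mulfVK // expf_neq0.
  by rewrite (rootP _) ?mulr0 // root_Cyclotomic_prim.
have prwV : m.-primitive_root w^-1.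
  have -> : w^-1 = w ^+ m.-1.
    by apply: (mulfI w0); rewrite mulfV // -exprS prednK // (prim_expr_order prw).
  by rewrite (prim_root_exp_coprime _ prw) coprimePn.
have gE : g = f`_0 *: f.
  have : pZtoQ f %| pZtoQ (g - f`_0 *: f).
    apply: (Cyclotomic_dvd prwV); rewrite pZtoQto rmorphB /= rootE.
    rewrite -mul_polyC rmorphM /= !hornerE (rootP gw).
    by rewrite (rootP (root_Cyclotomic_prim prwV)) mulr0 subr0.
  apply: contraTeq; rewrite -subr_eq0 => h0; apply/negP => fh.
  have szQ (p : {poly int}) : size (pZtoQ p) = size p by apply/size_map_inj_poly/rmorph0/intr_inj.
  have := dvdp_leq _ fh; rewrite -size_poly_gt0 !szQ size_poly_gt0 sf => /(_ h0).
  apply/negP; rewrite -ltnNge ltnS.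
  apply/leq_sizeP => j; rewrite leq_eqVlt coefB coefZ coef_poly => /predU1P[<-|Dj].
    by rewrite ltnSn subnn lf mulr1 subrr.
  by rewrite ltnS leqNgt Dj /= [f`_j]nth_default ?sf // mulr0 subrr.
have f1 : f.[1] != 0.
  have := root_CyclotomicC 1 m_gt0; rewrite rootE -[1](rmorph1 (intr : int -> algC)).
  rewrite horner_map /= intr_eq0 => ->; rewrite rmorph1.
  by apply: contraTN m_gt1 => /prim_order_dvd /(_ 1%N); rewrite expr1n eqxx dvdn1 => /eqP->.
have g1 : g.[1] = f.[1].
  rewrite !(@horner_coef_wide _ D.+1) ?size_poly ?sf // (reindex_inj rev_ord_inj).
  by apply: eq_bigr => j _; rewrite /= subSS coef_poly ltnS leq_subr subKn -1?ltnS // !expr1n.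
have f00 : f`_0 = 1.
  by apply: (mulIf f1); rewrite -hornerZ -gE g1 mul1r.
move=> iD; have := congr1 (fun p : {poly int} => p`_i) gE.
by rewrite f00 scale1r coef_poly ltnS iD.
Qed.
(** In odd degree, palindromicity would give Phi_m(-1) = -Phi_m(-1), but -1 has order at most 2 and
    is no root of Phi_m. *)
Lemma totient_even m : (2 < m)%N -> ~~ odd (totient m).
Proof.
move=> m_gt2; have m_gt1 := ltnW m_gt2; apply/negP => oD.
have fN1 : ('Phi_m).[-1] != 0.
  have := root_CyclotomicC (-1) (ltnW m_gt1).
  rewrite rootE -[1](rmorph1 (intr : int -> algC)) -rmorphN horner_map /= intr_eq0 => ->.
  rewrite rmorphN rmorph1; apply: contraTN m_gt2 => /prim_order_dvd /(_ 2).
  by rewrite sqrrN expr1n eqxx -leqNgt => /dvdn_leq->.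
have : ('Phi_m).[-1] = - ('Phi_m).[-1].
  rewrite !(@horner_coef_wide _ (totient m).+1) ?size_Cyclotomic //.
  rewrite [LHS](reindex_inj rev_ord_inj) -sumrN; apply: eq_bigr => j _ /=.
  have jD : (j <= totient m)%N by rewrite -ltnS.
  rewrite subSS Cyclotomic_symm // -mulrN; congr (_ * _).
  by rewrite -signr_odd oddB // oD /= -[in RHS]signr_odd; case: (odd j); rewrite ?opprK.
lia.
Qed.

(** * Writing Phi_m as a polynomial in z + 1/z *)

(* Dickson polynomials: D_k(z + 1/z) = z^k + z^-k. *)
Fixpoint dickson2 k : {poly int} * {poly int} :=
  if k is k'.+1 then let: (p, q) := dickson2 k' in (q, 'X * q - p) else (2%:P, 'X).

Definition dickson k := (dickson2 k).1.

Lemma dicksonSS k : dickson k.+2 = 'X * dickson k.+1 - dickson k.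
Proof. by rewrite /dickson /=; case: (dickson2 k). Qed.

Lemma horner_dickson (F : fieldType) (z : F) k : z != 0 ->
  (pZto F (dickson k)).[z + z^-1] = z ^+ k + z ^- k.
Proof.
move=> z0; suff [] : (pZto F (dickson k)).[z + z^-1] = z ^+ k + z ^- k /\
  (pZto F (dickson k.+1)).[z + z^-1] = z ^+ k.+1 + z ^- k.+1 by [].
elim: k => [|k [IH0 IH1]]; first by rewrite /dickson /= map_polyC map_polyX !hornerE invr1.
split=> //; rewrite dicksonSS rmorphB rmorphM /= map_polyX !hornerE IH0 IH1.
by rewrite !exprS !invfM; field; rewrite z0 expf_neq0.
Qed.

(** The index starts at 1 because D_0 = 2 is not monic. *)
Lemma dickson_lead k : (size (dickson k.+1) <= k.+2)%N /\ (dickson k.+1)`_k.+1 = 1.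
Proof.
suff [] : ((size (dickson k) <= k.+1)%N /\ (size (dickson k.+1) <= k.+2)%N) /\
  (dickson k.+1)`_k.+1 = 1 by case.
elim: k => [|k [[s0 s1] l1]].
  by rewrite /dickson /= size_polyX coefX size_polyC.
rewrite dicksonSS; split; first split=> //.
  rewrite (leq_trans (size_polyD _ _)) // size_polyN geq_max.
  apply/andP; split; last by rewrite (leq_trans s0) // leqW.
  by rewrite (leq_trans (size_polyMleq _ _)) ?size_polyX.
by rewrite coefB coefXM /= l1 nth_default ?subr0 ?(leqW s0).
Qed.

(** By symmetry the terms of index i and 2d - i add up to f_i z^d (z^(d-i) + z^-(d-i)), a Dickson
    value. One integral g serves all fields: it is evaluated over [rat], [algC] and [R[i]]. *)
Lemma Cyclotomic_half m (d := (totient m)./2) : (2 < m)%N ->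
  exists2 g : {poly int}, g \is monic /\ size g = d.+1
  & forall (F : fieldType) (z : F), z != 0 ->
      (pZto F 'Phi_m).[z] = z ^+ d * (pZto F g).[z + z^-1].
Proof.
move=> m_gt2; have m_gt1 := ltnW m_gt2.
have Dd : totient m = (d + d)%N by rewrite addnn halfK (negPf (totient_even m_gt2)) subn0.
have d_gt0 : (0 < d)%N.
  have : (0 < totient m)%N by rewrite totient_gt0 ltnW.
  by rewrite Dd addn_gt0 orbb.
set f := 'Phi_m; have sf : size f = (d + d).+1 by rewrite size_Cyclotomic Dd.
have symf i : (i <= d + d)%N -> f`_(d + d - i) = f`_i.
  by rewrite -Dd; apply: Cyclotomic_symm.
have f0 : f`_0 = 1.
  by rewrite -symf // subn0; have /monicP := Cyclotomic_monic m; rewrite /lead_coef sf.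
pose g := (f`_d)%:P + \sum_(i < d) f`_i *: dickson (d - i).
have sD (i : 'I_d) : (size (f`_i *: dickson (d - i)) <= (d - i).+1)%N.
  have := ltn_ord i; rewrite -subn_gt0; case: (d - i)%N => // k _.
  by rewrite (leq_trans (size_scale_leq _ _)) //; have [] := dickson_lead k.
have sg : (size g <= d.+1)%N.
  rewrite (leq_trans (size_polyD _ _)) // geq_max (leq_trans (size_polyC_leq1 _)) //=.
  apply: (leq_trans (size_sum _ _ _)); apply/bigmax_leqP => i _.
  by rewrite (leq_trans (sD i)) // ltnS leq_subr.
have gd : g`_d = 1.
  rewrite coefD coefC gtn_eqF // add0r coef_sum (bigD1 (Ordinal d_gt0)) //= subn0.
  rewrite coefZ f0 mul1r -{1 2}(prednK d_gt0); have [_ ->] := dickson_lead d.-1.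
  rewrite big1 ?addr0 // => i; rewrite -val_eqE /= -lt0n => i_gt0.
  by rewrite nth_default // (leq_trans (sD i)) // ltn_subrL i_gt0.
have sg' : size g = d.+1.
  apply/eqP; rewrite eqn_leq sg /= ltnNge; apply/negP => /leq_sizeP /(_ d (leqnn d)).
  by rewrite gd => /eqP; rewrite oner_eq0.
exists g; first by split=> //; rewrite monicE /lead_coef sg' gd.
move=> F z z0.
have szf : (size (pZto F f) <= d + d.+1)%N by rewrite (leq_trans (size_poly _ _)) ?sf ?addnS.
(* The sum splits into indices below d, the middle index d, and the upper half, which is reversed to
   face the lower one. *)
rewrite (horner_coef_wide _ szf) big_split_ord /= big_ord_recl /= addn0.
rewrite [X in _ + (_ + X)](reindex_inj rev_ord_inj) /= addrCA -big_split /=.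
rewrite rmorphD rmorph_sum /= map_polyC !hornerE horner_sum mulrDr coef_map mulrC /= mulr_sumr.
congr (_ + _); apply: eq_bigr => i _.
rewrite map_polyZ /= hornerZ horner_dickson // !coef_map /=.
have id := ltnW (ltn_ord i).
have -> : (d + bump 0 (d - i.+1) = d + d - i)%N by rewrite /bump; have := ltn_ord i; lia.
rewrite symf ?(leq_trans id) ?leq_addr // -mulrDr mulrCA [in RHS]mulrDr [in RHS]addrC.
congr (_ * (_ + _)); last first.
  by rewrite -exprD addnBA.
by rewrite -{2}(subnK id) addnC exprD mulfK // expf_neq0.
Qed.

(** * The function v and products over divisors *)

Lemma v_prime_power p k : prime p -> (0 < k)%N -> v (p ^ k) = p.
Proof.
move=> pp k_gt0; rewrite /v; apply: xget_unique => [|q [qp [l l_gt0 E]]].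
  by split=> //; exists k.
have : q \in primes (p ^ k) by rewrite E primesX // primes_prime ?inE.
by rewrite primesX // primes_prime // inE => /eqP.
Qed.

Lemma v_not_prime_power n :
  (forall p k, prime p -> (0 < k)%N -> n != (p ^ k)%N) -> v n = 1%N.
Proof.
move=> nP; rewrite /v; apply: xgetPN => p [pp [k k_gt0 E]].
by have := nP p k pp k_gt0; rewrite E eqxx.
Qed.

Lemma vP n : (exists2 p, prime p & exists2 k, (0 < k)%N & n = (p ^ k)%N /\ v n = p) \/
  (forall p k, prime p -> (0 < k)%N -> n != (p ^ k)%N) /\ v n = 1%N.
Proof.
have [[p [pp [k k_gt0 E]]]|nP] :=
    pselect (exists p, prime p /\ exists2 k, (0 < k)%N & n = (p ^ k)%N).
  by left; exists p => //; exists k => //; rewrite E v_prime_power.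
have nP' p k : prime p -> (0 < k)%N -> n != (p ^ k)%N.
  by move=> pp k_gt0; apply/eqP => E; apply: nP; exists p; split=> //; exists k.
by right; split=> //; apply: v_not_prime_power.
Qed.

Lemma v_gt0 n : (0 < v n)%N.
Proof. by have [[p pp [k _ [_ ->]]]|[_ ->]] := vP n; first exact: prime_gt0. Qed.

(** [v] is the exponential of the von Mangoldt function. For n = m p with p prime, the only prime
    power among the divisors of n that do not divide m is the full p-part p^a, which contributes the
    factor p. *)
Lemma prod_v n : (0 < n)%N -> (\prod_(d <- divisors n) v d)%N = n.
Proof.
elim/ltn_ind: n => n IHn n_gt0.
have [n1|n_gt1] := leqP n 1.
  have -> : n = 1%N by lia.
  rewrite big_seq1 v_not_prime_power // => p k pp k_gt0.
  by rewrite neq_ltn -[1%N](expn0 p) ltn_exp2l ?k_gt0 ?prime_gt1.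
have pp := pdiv_prime n_gt1; set p := pdiv n in pp.
have p_gt1 := prime_gt1 pp.
pose m := (n %/ p)%N; have nE : n = (m * p)%N by rewrite divnK ?pdiv_dvd.
have m_gt0 : (0 < m)%N by move: n_gt0; rewrite nE muln_gt0 => /andP[].
rewrite (bigID (fun d => d %| m)%N) /= [RHS]nE; congr (_ * _)%N.
  have mn : (m < n)%N by rewrite ltn_Pdiv.
  rewrite -big_filter -[RHS](IHn m mn m_gt0); apply: perm_big.
  apply: uniq_perm; rewrite ?filter_uniq ?divisors_uniq // => d.
  rewrite mem_filter -!dvdn_divisors //; apply: andb_idr => dm.
  by rewrite nE dvdn_mulr.
have [a aD] : exists a, a = logn p n by exists (logn p n).
have a_gt0 : (0 < a)%N by rewrite aD logn_gt0 mem_primes pp n_gt0 pdiv_dvd.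
have aE : a = (logn p m).+1.
  by rewrite aD nE lognM ?(ltnW p_gt1) // (logn_prime p pp) eqxx addn1.
rewrite -big_filter (bigD1_seq (p ^ a)%N) /=; last 2 first.
- by rewrite mem_filter -dvdn_divisors // !pfactor_dvdn // -aD leqnn aE ltnn.
- by rewrite filter_uniq ?divisors_uniq.
rewrite v_prime_power // -big_filter big1_seq ?muln1 // => d /andP[_].
rewrite !mem_filter -dvdn_divisors // => /and3P[dpa dm dn].
have [[q pq [k k_gt0 [dE _]]]|[_ ->]] := vP d; last by [].
case/negP: dm; have [qp|qp] := eqVneq q p.
  move: dpa dn; rewrite dE qp pfactor_dvdn // -aD => dpa kn.
  rewrite pfactor_dvdn // -ltnS -aE ltn_neqAle kn andbT.
  by apply: contraNneq dpa => ->.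
move: dn; rewrite nE Gauss_dvdl // dE coprimeXl //.
by rewrite prime_coprime // dvdn_prime2.
Qed.

(** Moebius inversion as a uniqueness statement: by induction the factors at proper divisors agree,
    and being nonzero they cancel. Hypotheses concern divisors of n only, so that conditions such as
    3 not dividing n can be carried along. *)
Lemma eq_prod_divisors (F : idomainType) (f g : nat -> F) n : (0 < n)%N ->
    (forall m, (m %| n)%N -> g m != 0) ->
    (forall m, (m %| n)%N ->
       \prod_(d <- divisors m) f d = \prod_(d <- divisors m) g d) ->
  f n = g n.
Proof.
elim/ltn_ind: n => n IHn n_gt0 g0 fg; have := fg n (dvdnn n).
have nn : n \in divisors n by rewrite -dvdn_divisors.
rewrite !(bigD1_seq n) ?divisors_uniq //=.
have -> : \prod_(d <- divisors n | d != n) f d = \prod_(d <- divisors n | d != n) g d.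
  rewrite big_seq_cond [RHS]big_seq_cond; apply: eq_bigr => d.
  rewrite -dvdn_divisors // => /andP[dn dn'].
  apply: IHn => [||m md|m md]; rewrite ?(dvdn_gt0 n_gt0 dn) //.
  - by rewrite ltn_neqAle dn' dvdn_leq.
  - by rewrite g0 // (dvdn_trans md dn).
  - by rewrite fg // (dvdn_trans md dn).
apply: mulIf; rewrite prodf_seq_neq0; apply/allP => d.
by rewrite -dvdn_divisors // => dn; rewrite g0 // implybT.
Qed.

(** * Products of cyclotomic polynomials and the value at 1 *)

Lemma Cyclotomic1 : 'Phi_1 = 'X - 1.
Proof. by have := prod_Cyclotomic (ltn0Sn 0); rewrite big_seq1. Qed.

Lemma prod_Cyclotomic_neq1 n : (0 < n)%N ->
  \prod_(d <- divisors n | d != 1%N) 'Phi_d = \sum_(i < n) 'X^i.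
Proof.
move=> n_gt0; have f1 : 'X - 1 != 0 :> {poly int} by rewrite polyXsubC_eq0.
apply: (mulfI f1); rewrite -subrX1 -prod_Cyclotomic //.
by rewrite [RHS](bigD1_seq 1%N) ?divisors_uniq -?dvdn_divisors // Cyclotomic1.
Qed.

(** Both sides are the quotient of X^(kn) - 1 by X^k - 1. *)
Lemma prod_Cyclotomic_ndvd k n : (0 < k)%N -> (0 < n)%N ->
  \prod_(d <- divisors (k * n) | ~~ (d %| k)%N) 'Phi_d = \sum_(i < n) 'X^(k * i).
Proof.
move=> k_gt0 n_gt0; have kn_gt0 : (0 < k * n)%N by rewrite muln_gt0 k_gt0.
have f1 : 'X^k - 1 != 0 :> {poly int} by rewrite monic_neq0 ?monicXnsubC.
apply: (mulfI f1); under [X in _ = _ * X]eq_bigr do rewrite exprM.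
rewrite -subrX1 -exprM -(prod_Cyclotomic kn_gt0) [RHS](bigID (fun d => d %| k)%N) /=.
congr (_ * _); rewrite -prod_Cyclotomic // -[RHS]big_filter; apply: perm_big.
apply: uniq_perm; rewrite ?filter_uniq ?divisors_uniq // => d.
rewrite mem_filter -!dvdn_divisors //; apply/esym/andb_idr => dk.
by rewrite dvdn_mulr.
Qed.

Lemma Cyclotomic_at1 n : (1 < n)%N -> ('Phi_n).[1] = (v n)%:Z.
Proof.
move=> n_gt1; have n_gt0 := ltnW n_gt1.
(* Phi_1(1) = 0 is replaced by 1, which is also [v 1]. *)
pose f d : int := if d == 1%N then 1 else ('Phi_d).[1].
have -> : ('Phi_n).[1] = f n by rewrite /f gtn_eqF.
apply: (eq_prod_divisors (g := fun d => (v d)%:Z)) => // m mn.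
  by rewrite eqz_nat -lt0n v_gt0.
have m_gt0 := dvdn_gt0 n_gt0 mn.
rewrite -(big_morph _ PoszM (erefl 1%:Z)) prod_v //.
transitivity (\prod_(d <- divisors m | d != 1%N) ('Phi_d).[1]).
  by rewrite [RHS]big_mkcond; apply: eq_bigr => d _; rewrite /f; case: eqP.
rewrite -horner_prod prod_Cyclotomic_neq1 // horner_sum.
under eq_bigr do rewrite hornerXn expr1n.
by rewrite sumr_const card_ord natz.
Qed.

(** * Absolute values at a primitive cube root of unity *)

Section CubeRoot.

Variable w : algC.
Hypothesis prw : 3.-primitive_root w.

Lemma cube_root_trace : w + w^-1 = -1.
Proof.
have w0 : w != 0 by rewrite (prim_root_eq0 prw).
have w1 : w != 1.
  apply/eqP => wE; have := prim_order_dvd prw 1; by rewrite wE expr1n eqxx.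
have w3 := prim_expr_order prw.
have E : w ^+ 2 + w + 1 = 0.
  apply: (mulfI (_ : w - 1 != 0)); first by rewrite subr_eq0.
  by rewrite mulr0 -[RHS](subrr 1) -{3}w3; ring.
apply: (mulfI w0); rewrite mulrDr mulfV //.
by apply/eqP; rewrite -subr_eq0 -E; apply/eqP; ring.
Qed.

(** Here w^n is w or w^2, and w^2 - 1 = -w^2 (w - 1) with |w| = 1. *)
Lemma norm_cube_root_sub1 n : ~~ (3 %| n)%N -> `|w ^+ n - 1| = `|w - 1|.
Proof.
have w0 : w != 0 by rewrite (prim_root_eq0 prw).
have w3 := prim_expr_order prw.
have nw : `|w| = 1.
  by apply/eqP; rewrite -(@pexpr_eq1 _ _ 3) // -normrX w3 normr1.
rewrite -(prim_expr_mod prw) /dvdn; have := ltn_pmod n (isT : 0 < 3)%N.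
case: (n %% 3)%N => [|[|[|]]] // _ _.
have -> : w ^+ 2 - 1 = - (w ^+ 2) * (w - 1) by move: w3; rewrite exprS => w3; ring: w3.
by rewrite normrM normrN normrX nw expr1n mul1r.
Qed.

(** For each m | n, the factor Phi_1(w) = w - 1 already accounts for |w^m - 1|, so the other factors
    have product of norm 1. *)
Lemma norm_Cyclotomic_cube_root n : (1 < n)%N -> ~~ (3 %| n)%N ->
  `|(pZto algC 'Phi_n).[w]| = 1.
Proof.
move=> n_gt1 n3; have n_gt0 := ltnW n_gt1.
pose f d := if d == 1%N then 1 else `|(pZto algC 'Phi_d).[w]|.
have -> : `|(pZto algC 'Phi_n).[w]| = f n by rewrite /f gtn_eqF.
apply: (eq_prod_divisors (g := fun=> 1)) => // [m _|m mn]; first exact: oner_neq0.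
have m_gt0 := dvdn_gt0 n_gt0 mn.
have m3 : ~~ (3 %| m)%N by apply: contra n3 => /dvdn_trans; apply.
rewrite big1_eq.
have w1 : `|w - 1| != 0.
  rewrite normr_eq0 subr_eq0; apply/eqP => wE.
  by have := prim_order_dvd prw 1; rewrite wE expr1n eqxx.
apply: (mulfI w1); rewrite mulr1 -[RHS](norm_cube_root_sub1 m3).
rewrite -horner_Xn_sub_1_Cyclotomic // normr_prod.
rewrite [RHS](bigD1_seq 1%N) ?divisors_uniq -?dvdn_divisors //=.
rewrite Cyclotomic1 rmorphB rmorph1 /= map_polyX !hornerE; congr (_ * _).
by rewrite [RHS]big_mkcond; apply: eq_bigr => d _; rewrite /f; case: eqP.
Qed.

(** For m | n, the quotient of X^(3m) - 1 by X^3 - 1 takes the value m at w, as does the product of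
    the v(d) over d | m. *)
Lemma norm_Cyclotomic_mul3_cube_root n : (1 < n)%N ->
  `|(pZto algC 'Phi_(3 * n)).[w]| = (v n)%:R.
Proof.
move=> n_gt1; have n_gt0 := ltnW n_gt1.
(* Phi_3(w) = 0 is the excluded factor. *)
pose f d := if d == 1%N then 1 else `|(pZto algC 'Phi_(3 * d)).[w]|.
have -> : `|(pZto algC 'Phi_(3 * n)).[w]| = f n by rewrite /f gtn_eqF.
apply: (eq_prod_divisors (g := fun d => (v d)%:R)) => // m mn.
  by rewrite pnatr_eq0 -lt0n v_gt0.
have m_gt0 := dvdn_gt0 n_gt0 mn.
rewrite -natr_prod prod_v //.
have w3 := prim_expr_order prw.
have := congr1 (fun p => `|(pZto algC p).[w]|) (prod_Cyclotomic_ndvd (isT : 0 < 3)%N m_gt0).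
rewrite /= rmorph_sum horner_sum /=.
under [X in _ = `|X|]eq_bigr do rewrite map_polyXn hornerXn exprM w3 expr1n.
rewrite sumr_const card_ord normr_nat => <-.
(* Divisors of 3m prime to 3 contribute norm 1; the others are 3e with e | m, and e = 1 is left
   out. *)
rewrite rmorph_prod horner_prod normr_prod [RHS](bigID (fun d => 3 %| d)%N) /=.
rewrite [X in _ = _ * X]big1_seq ?mulr1; last first.
  move=> d /andP[/andP[d3 dn3] dm]; apply: norm_Cyclotomic_cube_root => //.
  rewrite -dvdn_divisors ?muln_gt0 // in dm.
  have d_gt0 : (0 < d)%N by apply: dvdn_gt0 dm; rewrite muln_gt0.
  by rewrite ltn_neqAle d_gt0 andbT; apply: contraNneq d3 => <-; rewrite dvd1n.
transitivity (\prod_(d <- [seq (3 * e)%N | e <- divisors m] | ~~ (d %| 3)%N)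
    `|(pZto algC 'Phi_d).[w]|).
  rewrite big_map [RHS]big_mkcond; apply: eq_bigr => e _; rewrite /f.
  by rewrite -[X in (_ %| X)%N]muln1 dvdn_pmul2l // dvdn1; case: eqP.
under [RHS]eq_bigl do rewrite andbC.
rewrite -[RHS]big_filter_cond; apply: perm_big; apply: uniq_perm.
- by rewrite map_inj_uniq ?divisors_uniq // => a b /eqP; rewrite eqn_pmul2l // => /eqP.
- by rewrite filter_uniq ?divisors_uniq.
move=> d; rewrite mem_filter -dvdn_divisors ?muln_gt0 //; apply/mapP/andP.
  move=> [e]; rewrite -dvdn_divisors // => em ->.
  by rewrite dvdn_mulr // dvdn_pmul2l.
move=> [/dvdnP[e ->]]; rewrite mulnC dvdn_pmul2l // => em.
by exists e; rewrite -?dvdn_divisors.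
Qed.

End CubeRoot.

(** * Tools for the sign: reduction modulo 3 and powers of 3 *)

Lemma dvdz_horner_sub (p : {poly int}) (x y : int) : (x - y %| p.[x] - p.[y])%Z.
Proof.
have /factor_theorem[q E] : root (p - p.[y]%:P) y by rewrite rootE !hornerE subrr.
by have := congr1 (horner^~ x) E; rewrite !hornerE => ->; apply: dvdz_mull.
Qed.

(** The only divisor of 3n = 3^(k+2) that does not divide n is 3n itself. *)
Lemma Cyclotomic_mul3_pow3 k (n := (3 ^ k.+1)%N) :
  'Phi_(3 * n) = \sum_(i < 3) 'X^(n * i).
Proof.
have n_gt0 : (0 < n)%N by rewrite expn_gt0.
have n3E : (n * 3)%N = (3 ^ k.+2)%N by rewrite [RHS]expnSr.
have n3_gt0 : (0 < n * 3)%N by rewrite muln_gt0 n_gt0.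
have nn3 : (n * 3 %| n)%N = false.
  by rewrite -{2}[n]muln1 dvdn_pmul2l.
rewrite -prod_Cyclotomic_ndvd // -big_filter (bigD1_seq (n * 3)%N) /=; last 2 first.
- by rewrite mem_filter nn3 -dvdn_divisors /=.
- by rewrite filter_uniq ?divisors_uniq.
rewrite big1_seq => [|d /andP[dn3]]; first by rewrite mulr1 mulnC.
rewrite mem_filter -dvdn_divisors // n3E => /andP[dn /(dvdn_pfactor _ _ (isT : prime 3))[j jk dE]].
move: jk; rewrite leq_eqVlt => /predU1P[jE|jk].
  by move: dn3; rewrite dE jE n3E eqxx.
by case/negP: dn; rewrite dE dvdn_exp2l.
Qed.

(** * The root of unity exp(2 i pi/m) and its trace *)

Section Trigonometry.

Variable R : realType.
Local Open Scope complex_scope.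

Lemma cos_sin_exp (t : R) n :
  (cos t +i* sin t) ^+ n = cos (t *+ n) +i* sin (t *+ n).
Proof.
elim: n => [|n IHn]; first by rewrite expr0 mulr0n cos0 sin0.
rewrite exprS IHn mulrS cosD sinD; apply/eqP; rewrite eq_complex /= eqxx /=.
by rewrite addrC (mulrC (cos t)) eqxx.
Qed.

(** An order k < m would give cos(2 k pi/m) = 1, hence sin(k pi/m) = 0, although 0 < k pi/m < pi. *)
Lemma prim_root_cos_sin m (t := pi / m%:R *+ 2 : R) : (0 < m)%N ->
  m.-primitive_root (cos t +i* sin t).
Proof.
move=> m_gt0; have m0 : m%:R != 0 :> R by rewrite pnatr_eq0 -lt0n.
have zm : (cos t +i* sin t) ^+ m = 1.
  rewrite cos_sin_exp /t -mulrnA mulnC mulrnA -[_ *+ m]mulr_natr divfK //.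
  by rewrite cos2pi sin2pi.
have [k prk km] := prim_order_exists m_gt0 zm.
suff <- : k = m by [].
have k_gt0 := prim_order_gt0 prk.
have := prim_expr_order prk; rewrite cos_sin_exp => /eqP.
rewrite eq_complex /= => /andP[/eqP ck _].
apply/eqP; rewrite eqn_leq dvdn_leq //= leqNgt; apply/negP => k_lt.
have : 0 < sin (pi / m%:R *+ k : R).
  apply: sin_gt0_pi; rewrite pmulrn_lgt0 // divr_gt0 ?pi_gt0 ?ltr0n //=.
  rewrite -[_ *+ k]mulr_natr mulrAC ltr_pdivrMr ?ltr0n //.
  by rewrite ltr_pM2l ?pi_gt0 // ltr_nat.
move: ck; rewrite /t -mulrnA mulnC mulrnA cos_mulr2n cos2sin2 => ck s_gt0.
have : sin (pi / m%:R *+ k : R) ^+ 2 = 0 by lra.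
by move/eqP; rewrite expf_eq0 /= gt_eqF.
Qed.

Lemma cos_sin_addV (t : R) (z := cos (t *+ 2) +i* sin (t *+ 2)) :
  z + z^-1 = (2 - 4 * sin t ^+ 2)%:C.
Proof.
have z1 : z * (cos (t *+ 2) +i* - sin (t *+ 2)) = 1.
  apply/eqP; rewrite eq_complex /= -[X in X == 1](_ : cos (t *+ 2) ^+ 2 + sin (t *+ 2) ^+ 2 = _).
    by rewrite cos2Dsin2 eqxx /=; apply/eqP; ring.
  by ring.
have z0 : z != 0 by apply: contra_eq_neq z1 => ->; rewrite mul0r eq_sym oner_neq0.
have -> : z^-1 = cos (t *+ 2) +i* - sin (t *+ 2).
  by apply: (mulfI z0); rewrite mulfV.
apply/eqP; rewrite eq_complex /= subrr eqxx andbT; apply/eqP.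
by rewrite cos_mulr2n cos2sin2; ring.
Qed.

End Trigonometry.

(** * The minimal polynomial of 4 sin^2(pi/m) *)

(* X^(s-1) r(2 - X - 1/X), where s is the size of r. *)
Definition unfold_poly (r : {poly rat}) : {poly rat} :=
  \sum_(i < size r) r`_i *: ((- ('X - 1) ^+ 2) ^+ i * 'X^((size r).-1 - i)).

Lemma horner_unfold_poly (F : numFieldType) (r : {poly rat}) (z : F) : z != 0 ->
  (pQto F (unfold_poly r)).[z] = z ^+ (size r).-1 * (pQto F r).[2 - (z + z^-1)].
Proof.
move=> z0; rewrite [in RHS](@horner_coef_wide _ (size r)) ?size_map_poly //.
rewrite rmorph_sum horner_sum /= mulr_sumr; apply: eq_bigr => i _.
rewrite map_polyZ rmorphM !rmorphXn rmorphN rmorphXn rmorphB rmorph1 /= map_polyX.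
rewrite !hornerE coef_map /=.
have iE : (i <= (size r).-1)%N by rewrite -ltnS (ltn_predK (ltn_ord i)).
have -> : - (z - 1) ^+ 2 = z * (2 - (z + z^-1)) by field.
have -> : z ^+ (size r).-1 = z ^+ i * z ^+ ((size r).-1 - i) by rewrite -exprD subnKC.
by rewrite exprMn; move: (ratr _) => c; ring.
Qed.

Lemma size_unfold_poly (r : {poly rat}) : (size (unfold_poly r) <= ((size r).-1 * 2).+1)%N.
Proof.
apply: (leq_trans (size_sum _ _ _)); apply/bigmax_leqP => i _.
apply: (leq_trans (size_scale_leq _ _)); apply: (leq_trans (size_polyMleq _ _)).
rewrite size_polyXn addnS /=.
have sX : size (- ('X - 1 : {poly rat}) ^+ 2) = 3%N.
  by rewrite size_polyN size_exp_XsubC.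
have := size_poly_exp_leq (- ('X - 1 : {poly rat}) ^+ 2) i; rewrite sX => sE.
have iE : (i <= (size r).-1)%N by rewrite -ltnS (ltn_predK (ltn_ord i)).
have le2 (a b : nat) : (a <= b)%N -> ((2 * a).+1 + (b - a) <= (b * 2).+1)%N by lia.
exact: leq_trans (leq_add sE (leqnn _)) (le2 _ _ iE).
Qed.

(** At 0 only the top term survives, with value the leading coefficient of r up to sign. *)
Lemma unfold_poly_neq0 (r : {poly rat}) : r != 0 -> unfold_poly r != 0.
Proof.
move=> r0; have s_gt0 : (0 < size r)%N by rewrite size_poly_gt0.
apply/negP => /eqP /(congr1 (horner^~ 0)); rewrite horner0 horner_sum.
have lt_s : ((size r).-1 < size r)%N by rewrite prednK.
rewrite (bigD1 (Ordinal lt_s)) //= big1 ?addr0 => [|i].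
  rewrite subnn mulr1 hornerZ horner_exp !hornerE /= -lead_coefE => /eqP.
  by rewrite mulf_eq0 lead_coef_eq0 (negPf r0) sqrrN expr1n signr_eq0.
rewrite -val_eqE /= => iE; rewrite hornerZ hornerM hornerXn expr0n subn_eq0.
have -> : ((size r).-1 <= i)%N = false.
  by apply/negbTE; rewrite -ltnNge ltn_neqAle iE -ltnS prednK // ltn_ord.
by rewrite !mulr0.
Qed.

(** Two monic annihilators of least size differ by an annihilator of smaller size, hence by 0; the
    positive constant term then fixes the sign. *)
Lemma is_phi_unique (R : realType) m (p1 p2 : {poly int}) :
  is_phi R m p1 -> is_phi R m p2 -> p1 = p2.
Proof.
move=> [p1_gt0 [q1 [m1 r1 min1] E1]] [p2_gt0 [q2 [m2 r2 min2] E2]].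
have q12 : q1 = q2.
  have s12 : size q1 = size q2.
    by apply/eqP; rewrite eqn_leq min1 ?min2 ?monic_neq0.
  apply/eqP; rewrite -subr_eq0; apply/negPn/negP => q0.
  have rq : root (pQto R (q1 - q2)) (4 * sin (pi / m%:R : R) ^+ 2).
    by rewrite rmorphB rootE hornerD hornerN (rootP r1) (rootP r2) subrr.
  have := min1 _ q0 rq; apply/negP; rewrite -ltnNge.
  have s_gt0 : (0 < size q1)%N by rewrite size_poly_gt0 monic_neq0.
  rewrite -(prednK s_gt0) ltnS; apply/leq_sizeP => j.
  rewrite leq_eqVlt coefB => /predU1P[<-|jD].
    by have := monicP m2; rewrite -(monicP m1) !lead_coefE -s12 => ->; rewrite subrr.
  by rewrite !nth_default ?subrr -?s12 // -(prednK s_gt0).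
have E : p1 = p2 \/ p1 = - p2.
  have injQ : injective pZtoQ by apply/map_inj_poly/rmorph0/intr_inj.
  rewrite -q12 in E2.
  case: E1 E2 => [E1|E1] [E2|E2]; [left|right|right|left]; apply: injQ;
    by rewrite ?rmorphN /= E1 E2 ?opprK.
case: E => // pE; move: p1_gt0 p2_gt0; rewrite pE coefN oppr_gt0 => lt0 gt0.
by have := lt_trans lt0 gt0; rewrite ltxx.
Qed.

Lemma horner1_half m (g : {poly int}) d :
    (forall (F : fieldType) (z : F), z != 0 ->
      (pZto F 'Phi_m).[z] = z ^+ d * (pZto F g).[z + z^-1]) ->
  ('Phi_m).[1] = g.[2].
Proof.
move=> gE; apply: (@intr_inj rat).
rewrite -!horner_map /= gE ?oner_neq0 // expr1n mul1r; congr (_.[_]).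
Qed.

Lemma is_phi_comp (R : realType) m (g : {poly int}) (d := (totient m)./2) :
    (2 < m)%N -> g \is monic -> size g = d.+1 ->
    (forall (F : fieldType) (z : F), z != 0 ->
      (pZto F 'Phi_m).[z] = z ^+ d * (pZto F g).[z + z^-1]) ->
  is_phi R m (g \Po (2%:P - 'X)).
Proof.
move=> m_gt2 mg sg gE; have m_gt1 := ltnW m_gt2; have m_gt0 := ltnW m_gt1.
pose u : {poly int} := 2%:P - 'X; pose p := g \Po u.
have uE : u = - ('X - 2%:P) by rewrite opprB.
have su : size u = 2%N by rewrite uE size_polyN size_XsubC.
have lu : lead_coef u = -1 by rewrite uE lead_coefN lead_coefXsubC.
have sp : size p = d.+1 by rewrite size_comp_poly2 ?su.
have lp : lead_coef p = (-1) ^+ d.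
  by rewrite lead_coef_comp ?su // lu (monicP mg) mul1r sg.
rewrite /is_phi; set a := 4 * _ ^+ 2.
split; first last.
  (* Composing the monic g with 2 - X gives leading coefficient (-1)^d, which this scaling
     corrects. *)
  exists (pZtoQ ((-1) ^+ d *: p)); last first.
    rewrite -signr_odd; case: (odd d); [right|left].
      by rewrite expr1 scaleN1r rmorphN opprK.
    by rewrite expr0 scale1r.
  pose t : R := pi / m%:R.
  pose z : R[i] := (cos (t *+ 2) +i* sin (t *+ 2))%C.
  have prz : m.-primitive_root z by apply: prim_root_cos_sin.
  have z0 : z != 0 by rewrite (prim_root_eq0 prz) -lt0n.
  have zV : z + z^-1 = (2 - a)%:C%C by apply: cos_sin_addV.
  have aC (r : {poly rat}) : root (pQto R r) a = root (pQto R[i] r) (a%:C)%C.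
    have -> : pQto R[i] r = map_poly (real_complex R) (pQto R r).
      by rewrite -map_poly_comp; apply: eq_map_poly => c /=; rewrite fmorph_rat.
    by rewrite fmorph_root.
  have aE : (a%:C)%C = 2 - (z + z^-1).
    by rewrite zV rmorphB /= rmorph_nat opprB addrC subrK.
  split.
  - rewrite monic_map // monicE lead_coefZ lp -exprD addnn -mul2n exprM sqrrN.
    by rewrite !expr1n.
  - rewrite aC pZtoQto map_polyZ rootZ; last first.
      by rewrite rmorphXn rmorphN1 expf_neq0 ?oppr_eq0 ?oner_eq0.
    rewrite aE /p map_comp_poly rootE horner_comp rmorphB /= map_polyC map_polyX !hornerE /=.
    have : root (pZto R[i] 'Phi_m) z := root_Cyclotomic_prim prz.
    rewrite rootE gE // mulf_eq0 expf_eq0 (negPf z0) andbF /= => /eqP gz.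
    by rewrite [X in _.[X]](_ : _ = z + z^-1) ?gz //; ring.
  (* Minimality: Phi_m, of degree 2d, divides [unfold_poly r], of degree at most 2 (size r - 1), so
     size r is at least d + 1. *)
  move=> r r0; rewrite aC aE => ra.
  have rz : root (pQto R[i] (unfold_poly r)) z.
    by rewrite rootE horner_unfold_poly // (rootP ra) mulr0.
  have := dvdp_leq (unfold_poly_neq0 r0) (Cyclotomic_dvd prz rz).
  move=> /leq_trans /(_ (size_unfold_poly r)).
  have -> : size (pZtoQ ((-1) ^+ d *: p)) = d.+1.
    rewrite size_map_inj_poly ?rmorph0 //; last exact: intr_inj.
    by rewrite size_scale ?sp // signr_eq0.
  have -> : size (pZtoQ 'Phi_m) = (totient m).+1.
    by rewrite size_map_inj_poly ?rmorph0 ?size_Cyclotomic //; apply: intr_inj.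
  have r_gt0 : (0 < size r)%N by rewrite size_poly_gt0.
  have Dd : totient m = (d + d)%N by rewrite addnn halfK (negPf (totient_even m_gt2)) subn0.
  rewrite Dd; lia.
(* The constant term is g(2) = Phi_m(1) = v(m) > 0. *)
rewrite -horner_coef0 horner_comp hornerD hornerN hornerC hornerX subr0.
by rewrite -(horner1_half gE) Cyclotomic_at1 // ltz_nat v_gt0.
Qed.

(** * The value at 3 *)

Theorem theorem4 (R : realType) (n : nat) (hn : (3 <= n)%N) :
  (((v n)%:Z = 1 %[mod 3])%Z \/ v n = 3%N ->
     (phi R (3 * n)).[3] = (v n)%:Z) /\
  (((v n)%:Z = -1 %[mod 3])%Z ->
     (phi R (3 * n)).[3] = - (v n)%:Z).
Proof.
have n_gt1 : (1 < n)%N by apply: leq_trans hn.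
have n_gt0 := ltnW n_gt1.
have m_gt2 : (2 < 3 * n)%N by lia.
have [g [mg sg] gE] := Cyclotomic_half m_gt2.
have gP := is_phi_comp R m_gt2 mg sg gE.
have -> : phi R (3 * n) = g \Po (2%:P - 'X).
  by apply: xget_unique => // p /is_phi_unique; apply.
have -> : (g \Po (2%:P - 'X)).[3] = g.[-1].
  by rewrite horner_comp !hornerE.
have g2 := horner1_half gE.
have [w prw] := C_prim_root_exists (isT : 0 < 3)%N.
have w0 : w != 0 by rewrite (prim_root_eq0 prw).
have w3 := prim_expr_order prw.
have gw : (pZto algC 'Phi_(3 * n)).[w] = w ^+ (totient (3 * n))./2 * (g.[-1])%:~R.
  by rewrite gE // cube_root_trace // -[-1]/((- 1 : int)%:~R) horner_map.
(* If 3n is a prime power, the prime is 3, so n is a power of 3, with positive exponent since n >=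
   3. *)
have v_neq3 : v n != 3%N -> v (3 * n) = 1%N.
  have [[p pp [k k_gt0 [E vE]]]|[_ ->]] := vP (3 * n); last by [].
  have p3 : p = 3%N.
    have : (3 %| p ^ k)%N by rewrite -E dvdn_mulr.
    by rewrite Euclid_dvdX // k_gt0 andbT dvdn_prime2 // => /eqP.
  move: k_gt0 E; rewrite p3; case: k => // k _ /eqP; rewrite expnS eqn_pmul2l // => /eqP nE.
  rewrite nE v_prime_power ?eqxx //; case: k nE => // nE; move: hn; by rewrite nE.
have gv : `|g.[-1]|%N = v n.
  have := norm_Cyclotomic_mul3_cube_root prw n_gt1.
  have nw : `|w| = 1 by apply/eqP; rewrite -(@pexpr_eq1 _ _ 3) // -normrX w3 normr1.
  rewrite gw normrM normrX nw expr1n mul1r -intr_norm -abszE => /eqP.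
  by rewrite -pmulrn eqr_nat => /eqP.
have g3 : v n != 3%N -> (g.[-1] = 1 %[mod 3])%Z.
  move=> /v_neq3 v1; apply/eqP; rewrite eqz_mod_dvd.
  have := dvdz_horner_sub g 2 (-1).
  rewrite -g2 Cyclotomic_at1 ?v1; last by lia.
  by rewrite -opprB rpredN.
split=> [[v1|v3]|vN1].
(* Of the two values v(n) and -v(n), only one is 1 modulo 3. *)
- have /g3 : v n != 3%N by apply/eqP => v3; rewrite v3 in v1.
  lia.
(* Both 3 and -3 vanish modulo 3, so the sign needs the explicit form of Phi_3n: all three terms and
   w^d, with d = n, equal 1 at w. *)
- have [[p pp [k k_gt0 [E vE]]]|[_ vE]] := vP n; last by rewrite vE in v3.
  move: E; rewrite -vE v3; case: k k_gt0 => // k _ nE.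
  suff -> : g.[-1] = 3 by [].
  move: gw; rewrite {1}nE Cyclotomic_mul3_pow3 -nE.
  have -> : ((totient (3 * n))./2 = n)%N.
    by rewrite nE -expnS totient_pfactor //= mul2n doubleK.
  have -> : w ^+ n = 1 by rewrite nE expnS exprM w3 expr1n.
  rewrite rmorph_sum horner_sum /=.
  rewrite (eq_bigr (fun=> 1)) => [|i _]; last first.
    by rewrite map_polyXn hornerXn nE expnS -mulnA exprM w3 expr1n.
  rewrite sumr_const card_ord mul1r => /eqP.
  by rewrite pmulrn eqr_int => /eqP <-.
have /g3 : v n != 3%N by apply/eqP => v3; rewrite v3 in vN1.
lia.
Qed.
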